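(* There exist some $\upsilon>0$ and some $\Lambda_{\min},\Lambda_{\max}\in\mathbb{S}^+_{r_1}$ such that for any $t\geq\upsilon$ and any $Q\in\mathbb{S}^+_{r_1}$ we have $$\Lambda_{\min}\leq\phi_t(Q)\leq\Lambda_{\max}.$$
   Context: Let $r_1,r_2\ge 1$. $\mathbb{S}^+_{r}$ is the set of real symmetric positive definite $(r\times r)$-matrices, $'$ denotes transpose, $Id$ the identity, and $\leq$ between symmetric matrices is the Loewner order. Model: $t\in[0,\infty)\mapsto A_t\in\mathbb{R}^{r_1\times r_1}$ and $t\mapsto C_t\in\mathbb{R}^{r_2\times r_1}$ are smooth matrix flows, bounded uniformly in time; $R_1\in\mathbb{S}^+_{r_1}$ and $R_2\in\mathbb{S}^+_{r_2}$ are constant positive definite matrices. Set $S_t:=C_t'R_2^{-1}C_t$. Riccati flow: for $Q\in\mathbb{S}^+_{r_1}$ and $0\le s\le t$, $\phi_{s,t}(Q)$ denotes the solution of $$\partial_t\phi_{s,t}(Q)=A_t\phi_{s,t}(Q)+\phi_{s,t}(Q)A_t'-\phi_{s,t}(Q)S_t\phi_{s,t}(Q)+R_1,\qquad \phi_{s,s}(Q)=Q,$$ and $\phi_t(Q):=\phi_{0,t}(Q)$. Uniform observability/controllability (standing assumption): let $\mathcal{E}_{s,t}(A)$, $s\le t$, be the transition matrix given by $\partial_t\mathcal{E}_{s,t}(A)=A_t\mathcal{E}_{s,t}(A)$, $\mathcal{E}_{s,s}(A)=Id$, and set $$\mathcal{C}_{s,t}:=\int_s^t\mathcal{E}_{r,t}(A)R_1\mathcal{E}_{r,t}(A)'\,dr,\qquad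 \mathcal{O}_{s,t}:=\int_s^t\big(\mathcal{E}_{r,t}(A)^{-1}\big)'S_r\,\mathcal{E}_{r,t}(A)^{-1}\,dr.$$ It is assumed that there are parameters $\upsilon_0,\varpi^{c}_{\pm},\varpi^{o}_{\pm}>0$ such that, uniformly for all $t\ge0$, $$\varpi^c_-Id\le\mathcal{C}_{t,t+\upsilon_0}\le\varpi^c_+Id,\qquad \varpi^o_-Id\le\mathcal{O}_{t,t+\upsilon_0}\le\varpi^o_+Id.$$ *)

(* Defs.v *)
From mathcomp Require Import all_boot all_order all_algebra.
From mathcomp Require Import all_classical all_reals all_analysis.

Set Implicit Arguments.
Unset Strict Implicit.
Unset Printing Implicit Defensive.

Import Order.TTheory GRing.Theory Num.Theory.
Import numFieldNormedType.Exports.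

Local Open Scope classical_set_scope.
Local Open Scope ring_scope.

Definition spd (R : realType) (n : nat) (M : 'M[R]_n) : Prop :=
  M^T = M /\ forall x : 'cV[R]_n, x != 0 -> 0 < (x^T *m M *m x) 0 0.

Definition psd (R : realType) (n : nat) (M : 'M[R]_n) : Prop :=
  M^T = M /\ forall x : 'cV[R]_n, 0 <= (x^T *m M *m x) 0 0.

Definition loewner_le (R : realType) (n : nat) (M N : 'M[R]_n) : Prop :=
  psd (N - M).

(* Derivatives are relative to a time set D, so that they are one-sided at the
   end points of D; no condition is put on f outside D. *)
Definition has_derivative_on (R : realType) (V : normedModType R)
    (D : set R) (f df : R -> V) : Prop :=
  forall t, D t ->
    (u - t)^-1 *: (f u - f t) @[u --> within D (t^')] --> df t.

(* d k is the k-th derivative of f on D. *)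
Definition smooth_on (R : realType) (V : normedModType R)
    (D : set R) (f : R -> V) : Prop :=
  exists d : nat -> R -> V,
    (forall t, D t -> d 0%N t = f t) /\
    (forall k, has_derivative_on D (d k) (d k.+1)).

Definition is_transition_matrix (R : realType) (n : nat)
    (A : R -> 'M[R]_n) (E : R -> R -> 'M[R]_n) : Prop :=
  forall s, 0 <= s ->
    E s s = 1%:M /\
    has_derivative_on `[s, +oo[ (E s) (fun t => A t *m E s t).

Definition info_mx (R : realType) (r1 r2 : nat)
    (C : R -> 'M[R]_(r2, r1)) (R2 : 'M[R]_r2) (t : R) : 'M[R]_r1 :=
  (C t)^T *m invmx R2 *m C t.

Definition is_riccati_flow (R : realType) (r1 r2 : nat)
    (A : R -> 'M[R]_r1) (C : R -> 'M[R]_(r2, r1))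
    (R1 : 'M[R]_r1) (R2 : 'M[R]_r2)
    (phi : R -> R -> 'M[R]_r1 -> 'M[R]_r1) : Prop :=
  forall (s : R) (Q : 'M[R]_r1), 0 <= s -> spd Q ->
    phi s s Q = Q /\
    has_derivative_on `[s, +oo[ (fun t => phi s t Q)
      (fun t => A t *m phi s t Q + phi s t Q *m (A t)^T
                - phi s t Q *m info_mx C R2 t *m phi s t Q + R1).

Definition integral_mx (R : realType) (m n : nat) (s t : R)
    (F : R -> 'M[R]_(m, n)) : 'M[R]_(m, n) :=
  \matrix_(i, j) \int[@lebesgue_measure R]_(r in `[s, t]) F r i j.

Definition ctrl_gramian (R : realType) (n : nat) (E : R -> R -> 'M[R]_n)
    (R1 : 'M[R]_n) (s t : R) : 'M[R]_n :=
  integral_mx s t (fun r => E r t *m R1 *m (E r t)^T).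

Definition obs_gramian (R : realType) (r1 r2 : nat) (E : R -> R -> 'M[R]_r1)
    (C : R -> 'M[R]_(r2, r1)) (R2 : 'M[R]_r2) (s t : R) : 'M[R]_r1 :=
  integral_mx s t
    (fun r => (invmx (E r t))^T *m info_mx C R2 r *m invmx (E r t)).

(* Main.v *)
Require Import Defs.
From mathcomp Require Import all_boot all_order all_algebra.
From mathcomp Require Import all_classical all_reals all_analysis.
From mathcomp Require Import ring lra.

Set Implicit Arguments.
Unset Strict Implicit.
Unset Printing Implicit Defensive.

Import Order.TTheory GRing.Theory Num.Theory.
Import numFieldNormedType.Exports.

Local Open Scope classical_set_scope.
Local Open Scope ring_scope.

(** Write [P t] for [phi 0 t Q] and [F] for the transition matrix [E 0]. The
    argument watches the energy [y^T P y] along paths [y] driven by a signal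
    [q] through dy/dt = - A^T y + S q. Completing the square in the Riccati
    equation ([riccati_form_identity]) gives

      d/dt (y^T P y) = y^T R1 y + q^T S q - (P y - q)^T S (P y - q).

    Upper bound ([riccati_upper]). As S >= 0 the last term can be dropped, so
    over a window [s, T] of length upsilon0 the energy grows at most by the
    integral of y^T R1 y + q^T S q. The initial condition Q enters only
    through the energy at time s, and that energy vanishes if y s = 0.
    Observability provides such a path ending at a prescribed v: if O is the
    Gramian of the window, take for q the solution of dq/dt = A q with
    q T = O^-1 v; the state reached from 0 is then exactly O (O^-1 v) = v.
    Both q and y are bounded by a constant times |v| on the window, by
    Gronwall estimates that use only the bounds on A and S, the length of the
    window and the lower bound on O. Hence v^T (P T) v <= K |v|^2 with K
    independent of T and Q.

    Lower bound ([riccati_lower]). Take q = 0. On a window where 0 <= P <= K,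
    Cauchy-Schwarz for the form P gives |P y|^2 <= K y^T P y
    ([psd_sqr_le]), so the energy satisfies the linear inequality
    d/dt (y^T P y) >= rho0 |y|^2 - sigma K (y^T P y), where R1 >= rho0 and
    S <= sigma. Since |y| cannot be small compared with |v| = |y T| on the
    window and the energy at its beginning is nonnegative, Gronwall bounds
    v^T (P T) v from below by a multiple of |v|^2. Two windows are needed,
    the first one to make the upper bound available on the second: the
    theorem holds with upsilon = 2 upsilon0.

    Two facts about the flow come first. It is symmetric because P - P^T
    solves a linear equation with zero initial value ([riccati_sym]). It is
    positive semidefinite ([riccati_psd]) because, up to the first time at
    which positivity could fail, the inequality of the lower bound holds and
    keeps the energy above a positive multiple of |v|^2, which continuity
    then propagates a little further.

    Every path involved is written explicitly with F and its inverse, so no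
    existence theorem for differential equations is called for. *)

(** * One-sided calculus for real functions *)

(** The type [R^o] makes the scalar field a normed module over itself, so that
    scalar and matrix derivatives are instances of one notion. *)
Definition sderiv (R : realType) (D : set R) (f df : R -> R) : Prop :=
  @has_derivative_on R R^o D f df.

Lemma sderivP (R : realType) (D : set R) (f df : R -> R) :
  sderiv D f df <->
  (forall t, D t ->
     (u - t)^-1 * (f u - f t) @[u --> within D (t^')] --> df t).
Proof. by []. Qed.

Lemma sderiv_cont (R : realType) (D : set R) (f df : R -> R) (t : R) :
  sderiv D f df -> D t -> f u @[u --> within D (nbhs t)] --> f t.
Proof.
move=> /sderivP fD Dt; have {}fD := fD _ Dt.
have idD : u - t @[u --> within D t^'] --> (0 : R).
  rewrite -(subrr t); apply: cvgB; last exact: cvg_cst.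
  by apply: cvg_trans (cvg_within _) _; exact: cvg_within.
have fD0 : (u - t) * ((u - t)^-1 * (f u - f t)) @[u --> within D t^']
    --> (0 : R).
  by rewrite -(mul0r (df t)); apply: cvgM.
apply/cvgrPdist_lt => e e0.
move/cvgrPdist_lt : fD0 => /(_ _ e0); rewrite !near_withinE => fD0.
near=> u => Du.
have [->|ut] := eqVneq u t; first by rewrite subrr normr0.
have : D u -> `|0 - (u - t) * ((u - t)^-1 * (f u - f t))| < e.
  by move: ut; near: u.
move=> /(_ Du); rewrite mulrA mulfV ?subr_eq0// mul1r sub0r normrN.
by rewrite distrC.
Unshelve. all: by end_near. Qed.

Lemma sderiv_ext (R : realType) (D : set R) (f g df dg : R -> R) :
  sderiv D f df ->
  (forall t, D t -> f t = g t) -> (forall t, D t -> df t = dg t) ->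
  sderiv D g dg.
Proof.
move=> /sderivP fD fg dfg; apply/sderivP => t Dt; rewrite -dfg//.
apply: cvg_trans (fD _ Dt); apply: near_eq_cvg.
rewrite near_withinE; apply: nearW => u Du.
by rewrite !fg.
Qed.

Lemma sderiv_cst (R : realType) (D : set R) (c : R) :
  sderiv D (fun=> c) (fun=> 0).
Proof.
apply/sderivP => t Dt; under eq_fun do rewrite subrr mulr0.
exact: cvg_cst.
Qed.

Lemma sderivD (R : realType) (D : set R) (f g df dg : R -> R) :
  sderiv D f df -> sderiv D g dg ->
  sderiv D (fun t => f t + g t) (fun t => df t + dg t).
Proof.
move=> /sderivP fD /sderivP gD; apply/sderivP => t Dt.
have -> : (fun u => (u - t)^-1 * (f u + g u - (f t + g t))) =
   (fun u => (u - t)^-1 * (f u - f t) + (u - t)^-1 * (g u - g t)).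
  by apply/funext => u; ring.
by apply: cvgD; [exact: fD|exact: gD].
Qed.

Lemma sderivM (R : realType) (D : set R) (f g df dg : R -> R) :
  sderiv D f df -> sderiv D g dg ->
  sderiv D (fun t => f t * g t) (fun t => df t * g t + f t * dg t).
Proof.
move=> fD gD; apply/sderivP => t Dt.
have -> : (fun u => (u - t)^-1 * (f u * g u - (f t * g t))) =
   (fun u => (u - t)^-1 * (f u - f t) * g u
             + f t * ((u - t)^-1 * (g u - g t))).
  by apply/funext => u; ring.
apply: cvgD.
  apply: cvgM; first exact: fD.
  apply: cvg_trans (sderiv_cont gD Dt).
  apply: cvg_app.
  move=> P; rewrite /within/= !nbhs_filterE/=.
  by apply: filterS => u + _ .
by apply: cvgM; [exact: cvg_cst|exact: gD].
Qed.

Lemma sderiv_sum (R : realType) (D : set R) (I : Type) (r : seq I)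
    (f df : I -> R -> R) :
  (forall i, sderiv D (f i) (df i)) ->
  sderiv D (fun t => \sum_(i <- r) f i t) (fun t => \sum_(i <- r) df i t).
Proof.
move=> fD; elim: r => [|i r IH].

   by apply: (sderiv_ext (@sderiv_cst _ D 0)) => t _; rewrite big_nil.
by apply: (sderiv_ext (sderivD (fD i) IH)) => t _; rewrite big_cons.
Qed.

Lemma sderivN (R : realType) (D : set R) (f df : R -> R) :
  sderiv D f df -> sderiv D (fun t => - f t) (fun t => - df t).
Proof.
move=> fD; by apply: (sderiv_ext (sderivM (@sderiv_cst _ D (-1)) fD)) => t _; ring.
Qed.

Lemma sderiv_is_derive (R : realType) (f df : R -> R) (a t : R) :
  sderiv `[a, +oo[ f df -> a < t -> is_derive t 1 f (df t).
Proof.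
move=> /sderivP fD at_; have aT : `[a, +oo[%classic t.
  by rewrite /= in_itv/= andbT ltW.
have {}fD := fD _ aT.
have fD' : (u - t)^-1 * (f u - f t) @[u --> t^'] --> df t.
  apply: cvg_trans fD; apply: cvg_app => P.
  rewrite /within/= !nbhs_filterE/= => H.
  have aN : \forall u \near t, a < u.
    by apply: open_nbhs_nbhs; split => //; exact: open_gt.
  apply: filterS (filterI aN H) => u [au Pu] ut; apply: Pu => //.
  by rewrite /= in_itv/= andbT ltW.
suff fD2 : h^-1 *: (((f \o shift t) (h *: (1:R)) - f t : R^o)) @[h --> 0^'] --> df t.
  by apply: DeriveDef; [apply/cvg_ex; exists (df t)|exact: cvg_lim].
apply/cvgrPdist_lt => e e0; move/cvgrPdist_lt : fD' => /(_ _ e0).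
rewrite !near_withinE /prop_near1/= => /nbhs_ballP[d /= d0 dP].
apply/nbhs_ballP; exists d => //= h hd h0.
have := dP (h + t); rewrite /ball/= in hd *.
rewrite opprD addrCA subrr addr0 normrN => /(_ _ _).
rewrite sub0r normrN in hd; move=> /(_ hd).
rewrite -subr_eq0 addrK => /(_ h0).
by rewrite /GRing.scale/= mulr1.
Qed.

Lemma is_derive_sderiv (R : realType) (D : set R) (f df : R -> R) :
  (forall t : R, D t -> is_derive t 1 f (df t)) -> sderiv D f df.
Proof.
move=> fD; apply/sderivP => t Dt; have [fd1 fd2] := fD t Dt.
have : h^-1 *: (((f \o shift t) (h *: (1:R)) - f t : R^o)) @[h --> 0^'] --> df t.
  rewrite -fd2; exact: fd1.
move=> H; apply: cvg_trans (cvg_app _ (cvg_within _)) _.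
apply/cvgrPdist_lt => e e0; move/cvgrPdist_lt : H => /(_ _ e0).
rewrite !near_withinE /prop_near1/= => /nbhs_ballP[d /= d0 dP].
apply/nbhs_ballP; exists d => //= u ud u0.
have := dP (u - t); rewrite /ball/= in ud *.
rewrite sub0r normrN distrC => /(_ ud).
by rewrite subr_eq0 => /(_ u0); rewrite /GRing.scale/= mulr1 subrK.
Qed.

Lemma sderiv_within_continuous (R : realType) (f df : R -> R) (a s t : R) :
  sderiv `[a, +oo[ f df -> a <= s -> {within `[s, t], continuous f}.
Proof.
move=> fD as_; apply: (@continuous_subspaceW _ _ _ `[a, +oo[).
  by move=> x /=; rewrite !in_itv/= andbT => /andP[sx _]; exact: le_trans sx.
apply/subspace_continuousP => x Dx; exact: sderiv_cont fD Dx.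
Qed.

(** At an interior point of the time interval the relative derivative is a
    two-sided one, so the mean value theorem applies; the end point [s], which
    may be [a] itself, only matters through continuity. *)
Lemma sderiv_ge0_le (R : realType) (f df : R -> R) (a s t : R) :
  sderiv `[a, +oo[ f df -> a <= s -> s <= t ->
  (forall r, s < r < t -> 0 <= df r) -> f s <= f t.
Proof.
move=> fD as_ st df0.
have D r : r \in `]s, t[ -> is_derive r 1 f (df r).
  rewrite in_itv/= => /andP[sr _]; apply: sderiv_is_derive fD _.
  exact: le_lt_trans sr.
apply: (@ger0_derive1_le_cc _ f s t) => //; rewrite ?bound_itvE//.
- by move=> r /D[].
- move=> r rst; rewrite derive1E; have [_ ->] := D r rst.
  by apply: df0; move: rst; rewrite in_itv.
- exact: sderiv_within_continuous fD as_.
Qed.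

(** The function [expR (- c * r) * (f r + k / c)] is nondecreasing. No sign is
    imposed on [c]: a positive [c] gives growth, a negative one bounds the
    decay, and applying it to [- f] gives the upper estimates. *)
Lemma sderiv_gronwall (R : realType) (f df : R -> R) (a s t c k : R) :
  sderiv `[a, +oo[ f df -> a <= s -> s <= t -> c != 0 ->
  (forall r, s < r < t -> c * f r + k <= df r) ->
  expR (c * (t - s)) * (f s + k / c) <= f t + k / c.
Proof.
move=> fD as_ st c0 dfk.
have eD : sderiv `[a, +oo[ (fun r => expR (- c * r)) (fun r => - c * expR (- c * r)).
  apply: is_derive_sderiv => r _.
  have lD : is_derive r (1 : R) (fun r : R => - c * r : R) (- c).
    have := @is_deriveZ R R^o R^o id (- c) r 1 1 (is_derive_id _ _).
    by rewrite /GRing.scale/= mulr1.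
  have := is_derive1_comp (is_derive_expR (- c * r)) lD.
  by rewrite mulrC.
have := sderivM eD (sderivD fD (@sderiv_cst _ _ (k / c))).
move=> /sderiv_ge0_le/(_ as_ st) H.
have {H} : expR (- c * s) * (f s + k / c) <= expR (- c * t) * (f t + k / c).
  apply: H => r rst.
  rewrite addr0 (_ : _ + _ = expR (- c * r) * (df r - (c * f r + k))).
    by rewrite mulr_ge0 ?expR_ge0// subr_ge0 dfk.
  by field.
rewrite -(ler_pM2l (expR_gt0 (c * t))) !mulrA -!expRD.
by rewrite !mulNr subrr expR0 mul1r -mulrBr.
Qed.

(** * Quadratic forms and entrywise bounds *)

Definition form (R : realType) (m n : nat) (M : 'M[R]_(m, n))
  (x : 'cV[R]_m) (y : 'cV[R]_n) : R := (x^T *m M *m y) 0 0.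

Definition sqn (R : realType) (n : nat) (x : 'cV[R]_n) : R :=
  (x^T *m x) 0 0.

Definition entry_le (R : realType) (m n : nat) (M : 'M[R]_(m, n)) (b : R) :=
  forall i j, `|M i j| <= b.

Lemma sqnE (R : realType) (n : nat) (x : 'cV[R]_n) :
  sqn x = \sum_i x i 0 ^+ 2.
Proof.
by rewrite /sqn mxE; apply: eq_bigr => i _; rewrite mxE expr2.
Qed.

Lemma sqn_ge0 (R : realType) (n : nat) (x : 'cV[R]_n) : 0 <= sqn x.
Proof. by rewrite sqnE sumr_ge0// => i _; rewrite sqr_ge0. Qed.

Lemma sqn_eq0 (R : realType) (n : nat) (x : 'cV[R]_n) : sqn x = 0 -> x = 0.
Proof.
rewrite sqnE => /eqP; rewrite psumr_eq0; last by move=> i _; rewrite sqr_ge0.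
move=> /allP x0; apply/matrixP => i j; rewrite (ord1 j) [RHS]mxE.
by have := x0 i (mem_index_enum _); rewrite /= sqrf_eq0 => /eqP.
Qed.

Lemma sqn0 (R : realType) (n : nat) : sqn (0 : 'cV[R]_n) = 0.
Proof. by rewrite /sqn mulmx0 mxE. Qed.

Lemma formE (R : realType) (m n : nat) (M : 'M[R]_(m, n)) x y :
  form M x y = \sum_i \sum_j x i 0 * M i j * y j 0.
Proof.
rewrite /form -mulmxA mxE; apply: eq_bigr => i _.
rewrite !mxE mulr_sumr; apply: eq_bigr => j _; by rewrite mulrA.
Qed.

Lemma formDl (R : realType) (m n : nat) (M : 'M[R]_(m, n)) x1 x2 y :
  form M (x1 + x2) y = form M x1 y + form M x2 y.
Proof. by rewrite /form linearD/= !mulmxDl mxE. Qed.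

Lemma formDr (R : realType) (m n : nat) (M : 'M[R]_(m, n)) x y1 y2 :
  form M x (y1 + y2) = form M x y1 + form M x y2.
Proof. by rewrite /form mulmxDr mxE. Qed.

Lemma formZl (R : realType) (m n : nat) (M : 'M[R]_(m, n)) a x y :
  form M (a *: x) y = a * form M x y.
Proof. by rewrite /form linearZ/= -!scalemxAl mxE. Qed.

Lemma formZr (R : realType) (m n : nat) (M : 'M[R]_(m, n)) a x y :
  form M x (a *: y) = a * form M x y.
Proof. by rewrite /form -scalemxAr mxE. Qed.

Lemma formMD (R : realType) (m n : nat) (M N : 'M[R]_(m, n)) x y :
  form (M + N) x y = form M x y + form N x y.
Proof. by rewrite /form mulmxDr mulmxDl mxE. Qed.

Lemma formMN (R : realType) (m n : nat) (M : 'M[R]_(m, n)) x y :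
  form (- M) x y = - form M x y.
Proof. by rewrite /form mulmxN mulNmx mxE. Qed.

Lemma form_tr (R : realType) (m n : nat) (M : 'M[R]_(m, n)) x y :
  form M x y = form M^T y x.
Proof.
rewrite /form; have -> : x^T *m M *m y = (y^T *m M^T *m x)^T.
  by rewrite !trmx_mul !trmxK mulmxA.
by rewrite mxE.
Qed.

(** Each term is bounded by |x_i y_j| <= x_i^2 + y_j^2; the constant is not
    sharp, and only its independence of [x] and [y] matters below. *)
Lemma form_le (R : realType) (m n : nat) (M : 'M[R]_(m, n)) b x y :
  0 <= b -> entry_le M b ->
  `|form M x y| <= b * (n%:R * sqn x + m%:R * sqn y).
Proof.
move=> b0 Mb; rewrite formE.
apply: (@le_trans _ _ (\sum_i \sum_j b * (x i 0 ^+ 2 + y j 0 ^+ 2))).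
  apply: le_trans (ler_norm_sum _ _ _) _; apply: ler_sum => i _.
  apply: le_trans (ler_norm_sum _ _ _) _; apply: ler_sum => j _.
  rewrite !normrM mulrAC (mulrC b) ler_pM ?mulr_ge0//.
  rewrite -(real_normK (num_real (x i 0))) -(real_normK (num_real (y j 0))).
  have := sqr_ge0 (`|x i 0| - `|y j 0|).
  have := sqr_ge0 (`|x i 0| + `|y j 0|); nra.
rewrite le_eqVlt; apply/orP; left; apply/eqP.
under eq_bigr do rewrite -mulr_sumr big_split/= sumr_const card_ord -sqnE.
by rewrite -mulr_sumr big_split/= sumr_const card_ord sumrMnl -sqnE !mulr_natl.
Qed.

Lemma form_sqn_le (R : realType) (n : nat) (M : 'M[R]_n) b x :
  0 <= b -> entry_le M b -> `|form M x x| <= b * (2 * n%:R + 1) * sqn x.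
Proof.
move=> b0 Mb; apply: le_trans (form_le x x b0 Mb) _.
have := mulr_ge0 b0 (sqn_ge0 x); nra.
Qed.

Lemma entry_le_mul (R : realType) (m n p : nat) (M : 'M[R]_(m, n))
    (N : 'M[R]_(n, p)) a b :
  entry_le M a -> entry_le N b -> entry_le (M *m N) (n%:R * (a * b)).
Proof.
move=> Ma Nb i j; rewrite mxE; apply: le_trans (ler_norm_sum _ _ _) _.
apply: (@le_trans _ _ (\sum_(k < n) a * b)).
  by apply: ler_sum => k _; rewrite normrM ler_pM.
by rewrite sumr_const card_ord mulr_natl.
Qed.

Lemma entry_le_tr (R : realType) (m n : nat) (M : 'M[R]_(m, n)) a :
  entry_le M a -> entry_le M^T a.
Proof. by move=> Ma i j; rewrite mxE. Qed.

(** Entrywise bounds, uniform over [D], are combined into one by adding up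
    their absolute values; the summand 1 makes the bound positive. *)
Lemma entry_le_ex (R : realType) (m n : nat) (M : R -> 'M[R]_(m, n))
    (D : set R) :
  (forall i j, exists b, forall t, D t -> `|M t i j| <= b) ->
  exists2 b, 0 < b & forall t, D t -> entry_le (M t) b.
Proof.
move=> H.
have [b bP] : {b : 'I_m -> 'I_n -> R |
    forall i j t, D t -> `|M t i j| <= b i j}.
  have [b bP] := choice (fun ij : 'I_m * 'I_n => H ij.1 ij.2).
  by exists (fun i j => b (i, j)) => i j; exact: bP (i, j).
exists (1 + \sum_i \sum_j `|b i j|).
  rewrite ltr_wpDr// sumr_ge0// => i _; rewrite sumr_ge0// => j _.
move=> t Dt i j; apply: le_trans (bP i j t Dt) _.
apply: le_trans (ler_norm _) _.
have h1 : `|b i j| <= \sum_k `|b i k| by rewrite (bigD1 j)//= lerDl sumr_ge0.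
have h2 : \sum_k `|b i k| <= \sum_i \sum_k `|b i k|.
  by rewrite [leRHS](bigD1 i)//= lerDl sumr_ge0// => k _; rewrite sumr_ge0.
by apply: le_trans h1 (le_trans h2 _); rewrite lerDr.
Qed.

Lemma entry_le_bounded (R : realType) (m n : nat) (M : R -> 'M[R]_(m, n))
    (D : set R) :
  [bounded M t | t in D] ->
  exists2 b, 0 < b & forall t, D t -> entry_le (M t) b.
Proof.
move=> [b [_ bM]]; apply: entry_le_ex => i j; exists (b + 1) => t Dt.
have := bM (b + 1); rewrite ltrDl ltr01 => /(_ isT t Dt) /=.
apply: le_trans; rewrite [leRHS]/Num.norm/= mx_normrE.
by rewrite (le_bigmax_cond _ (fun ij => `|M t ij.1 ij.2|) (j := (i, j))).
Qed.

Lemma unitmx_inj (R : realType) (n : nat) (M : 'M[R]_n) :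
  (forall x : 'cV[R]_n, M *m x = 0 -> x = 0) -> M \in unitmx.
Proof.
move=> M0; rewrite -unitmx_tr -row_free_unit; apply: inj_row_free => v vM.
apply: (can_inj (@trmxK _ _ _)); rewrite trmx0; apply: M0.
by apply: (can_inj (@trmxK _ _ _)); rewrite trmx_mul trmxK vM trmx0.
Qed.

(** The polynomial t |-> form M (x + t y) (x + t y) is nonnegative. If its
    leading coefficient vanishes so must the linear one; otherwise evaluate at
    the minimiser. *)
Lemma psd_cauchy_schwarz (R : realType) (n : nat) (M : 'M[R]_n) x y :
  psd M -> form M x y ^+ 2 <= form M x x * form M y y.
Proof.
move=> [Ms M0].
have H t : 0 <= form M x x + 2 * t * form M x y + t ^+ 2 * form M y y.
  have := M0 (x + t *: y); rewrite -/(form _ _ _).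
  rewrite formDl !formDr !formZl !formZr (form_tr M y x) Ms.
  by congr (0 <= _); ring.
have [y0|y0] := eqVneq (form M y y) 0.
  rewrite y0 mulr0; have [-> //|xy0] := eqVneq (form M x y) 0.
    by rewrite expr0n.
  (* the affine function t |-> form M x x + 2 t form M x y is -1 here *)
  have := H (- (form M x x + 1) / (2 * form M x y)).
  rewrite y0 mulr0 addr0.
  have -> : 2 * (- (form M x x + 1) / (2 * form M x y)) * form M x y
    = - (form M x x + 1) by field.
  by rewrite opprD addrA subrr sub0r lerNr oppr0 ler10.
have yp : 0 < form M y y by rewrite lt_neqAle eq_sym y0; exact: M0.
have := H (- form M x y / form M y y).
rewrite -(ler_pM2r yp) mul0r.
have -> : (form M x x + 2 * (- form M x y / form M y y) * form M x y +
   (- form M x y / form M y y) ^+ 2 * form M y y) * form M y y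
   = form M x x * form M y y - form M x y ^+ 2 by field.
by rewrite subr_ge0.
Qed.

(** Apply Cauchy-Schwarz to [x] and [M x]: |M x|^4 <= (x^T M x) ((M x)^T M (M
    x)), and bound the second factor by lam |M x|^2. *)
Lemma psd_sqr_le (R : realType) (n : nat) (M : 'M[R]_n) lam :
  0 <= lam -> psd M -> (forall x, form M x x <= lam * sqn x) ->
  forall x, sqn (M *m x) <= lam * form M x x.
Proof.
move=> lam0 Mp Mlam x.
have := psd_cauchy_schwarz x (M *m x) Mp.
have [Ms M0] := Mp.
have -> : form M x (M *m x) = sqn (M *m x).
  by rewrite /form /sqn trmx_mul Ms.
have [->|s0] := eqVneq (sqn (M *m x)) 0.
  by move=> _; rewrite mulr_ge0//; exact: M0.
have sp : 0 < sqn (M *m x) by rewrite lt_neqAle eq_sym s0 sqn_ge0.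
move=> H; rewrite -(ler_pM2r sp) -expr2; apply: le_trans H _.
by rewrite (mulrC lam) -mulrA ler_wpM2l//; exact: M0.
Qed.

Lemma spd_psd (R : realType) (n : nat) (M : 'M[R]_n) : spd M -> psd M.
Proof.
move=> [Ms Mp]; split=> // x; have [->|x0] := eqVneq x 0.
  by rewrite mulmx0 mxE.
exact/ltW/Mp.
Qed.

Lemma spd_unit (R : realType) (n : nat) (M : 'M[R]_n) : spd M -> M \in unitmx.
Proof.
move=> [_ Mp]; apply: unitmx_inj => x Mx; apply/eqP.
apply: contraT => /Mp; by rewrite -mulmxA Mx mulmx0 mxE ltxx.
Qed.

Lemma entry_le_ex1 (R : realType) (m n : nat) (M : 'M[R]_(m, n)) :
  exists2 b, 0 < b & entry_le M b.
Proof.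
have [|b b0 Mb] := @entry_le_ex _ _ _ (fun=> M) setT.
  by move=> i j; exists `|M i j|.
by exists b => //; exact: (Mb 0).
Qed.

Lemma psd_invmx (R : realType) (n : nat) (M : 'M[R]_n) :
  spd M -> psd (invmx M).
Proof.
move=> Mp; have Mu := spd_unit Mp; have [Ms _] := Mp.
split; first by rewrite trmx_inv Ms.
move=> x; have := (spd_psd Mp).2 (invmx M *m x).
by rewrite trmx_mul trmx_inv Ms !mulmxA mulmxKV.
Qed.

(** Coercivity without compactness of the sphere: Cauchy-Schwarz for the form
    [M] at [x] and [M^-1 x] reads |x|^4 <= (x^T M x) (x^T M^-1 x), and the
    second factor is at most c |x|^2. *)
Lemma spd_lower (R : realType) (n : nat) (M : 'M[R]_n) :
  spd M -> exists2 q, 0 < q & forall x, q * sqn x <= form M x x.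
Proof.
move=> Mp; have Mu := spd_unit Mp; have [Ms _] := Mp.
have [b b0 Mb] := entry_le_ex1 (invmx M).
pose c := b * (2 * n%:R + 1).
have c0 : 0 < c by rewrite mulr_gt0// ltr_wpDl// mulr_ge0.
exists c^-1; first by rewrite invr_gt0.
move=> x; rewrite ler_pdivrMl//.
have := psd_cauchy_schwarz x (invmx M *m x) (spd_psd Mp).
have -> : form M x (invmx M *m x) = sqn x.
  by rewrite /form /sqn mulmxA mulmxK.
have -> : form M (invmx M *m x) (invmx M *m x) = form (invmx M) x x.
  by rewrite /form trmx_mul trmx_inv Ms !mulmxA mulmxKV.
have [->|s0] := eqVneq (sqn x) 0.
  by move=> _; rewrite mulr_ge0 ?(ltW c0)//; exact: (spd_psd Mp).2.
have sp : 0 < sqn x by rewrite lt_neqAle eq_sym s0 sqn_ge0.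
move=> H; rewrite -(ler_pM2r sp) -expr2; apply: le_trans H _.
rewrite (mulrC c) -mulrA ler_wpM2l//; first exact: (spd_psd Mp).2.
by apply: le_trans (ler_norm _) (form_sqn_le _ (ltW b0) Mb).
Qed.

(** * Entrywise calculus for matrix functions *)

(** Working entry by entry reduces every rule to its scalar version. *)
Definition mderiv (R : realType) (m n : nat) (D : set R)
    (M dM : R -> 'M[R]_(m, n)) : Prop :=
  forall i j, sderiv D (fun t => M t i j) (fun t => dM t i j).

Lemma has_derivative_mderiv (R : realType) (m n : nat) (D : set R)
    (M dM : R -> 'M[R]_(m, n)) :
  has_derivative_on D M dM -> mderiv D M dM.
Proof.
move=> MD i j; apply/sderivP => t Dt.
have -> : (fun u => (u - t)^-1 * (M u i j - M t i j)) =
  (fun N : 'M[R]_(m, n) => N i j) \o (fun u => (u - t)^-1 *: (M u - M t)).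
  by apply/funext => u /=; rewrite !mxE.
apply: continuous_cvg; first exact: coord_continuous.
exact: MD.
Qed.

Lemma mderiv_ext (R : realType) (m n : nat) (D : set R)
    (M dM N dN : R -> 'M[R]_(m, n)) :
  mderiv D M dM ->
  (forall t, D t -> M t = N t) -> (forall t, D t -> dM t = dN t) ->
  mderiv D N dN.
Proof.
move=> MD MN dMN i j.
by apply: (sderiv_ext (MD i j)) => t Dt; rewrite ?MN ?dMN.
Qed.

Lemma mderiv_subset (R : realType) (m n : nat) (a b : R)
    (M dM : R -> 'M[R]_(m, n)) : a <= b ->
  mderiv `[a, +oo[ M dM -> mderiv `[b, +oo[ M dM.
Proof.
move=> ab MD i j; apply/sderivP => t bt.
have at_ : `[a, +oo[%classic t.
  by move: bt; rewrite /= !in_itv/= !andbT; exact: le_trans.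
have /sderivP/(_ t at_) := MD i j; apply: cvg_trans.
apply: cvg_app => P; rewrite /within/= !nbhs_filterE/=; apply: filterS => u + bu.
apply; move: bu; rewrite /= !in_itv/= !andbT; exact: le_trans.
Qed.

Lemma mderiv_cst (R : realType) (m n : nat) (D : set R) (M : 'M[R]_(m, n)) :
  mderiv D (fun=> M) (fun=> 0).
Proof.
by move=> i j; apply: (sderiv_ext (@sderiv_cst _ D (M i j))) => t _; rewrite ?mxE.
Qed.

Lemma mderivD (R : realType) (m n : nat) (D : set R)
    (M dM N dN : R -> 'M[R]_(m, n)) :
  mderiv D M dM -> mderiv D N dN ->
  mderiv D (fun t => M t + N t) (fun t => dM t + dN t).
Proof.
move=> MD ND i j.
by apply: (sderiv_ext (sderivD (MD i j) (ND i j))) => t _; rewrite mxE.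
Qed.

Lemma mderivN (R : realType) (m n : nat) (D : set R)
    (M dM : R -> 'M[R]_(m, n)) :
  mderiv D M dM -> mderiv D (fun t => - M t) (fun t => - dM t).
Proof.
by move=> MD i j; apply: (sderiv_ext (sderivN (MD i j))) => t _; rewrite mxE.
Qed.

Lemma mderivT (R : realType) (m n : nat) (D : set R)
    (M dM : R -> 'M[R]_(m, n)) :
  mderiv D M dM -> mderiv D (fun t => (M t)^T) (fun t => (dM t)^T).
Proof.
by move=> MD i j; apply: (sderiv_ext (MD j i)) => t _; rewrite mxE.
Qed.

Lemma mderivM (R : realType) (m n p : nat) (D : set R)
    (M dM : R -> 'M[R]_(m, n)) (N dN : R -> 'M[R]_(n, p)) :
  mderiv D M dM -> mderiv D N dN ->
  mderiv D (fun t => M t *m N t) (fun t => dM t *m N t + M t *m dN t).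
Proof.
move=> MD ND i j.
have H := @sderiv_sum _ D _ (index_enum _) _ _
  (fun k => sderivM (MD i k) (ND k j)).
apply: (sderiv_ext H) => t _.
  by rewrite mxE.
by rewrite !mxE big_split.
Qed.

Lemma mderiv_form (R : realType) (m n : nat) (D : set R)
    (M dM : R -> 'M[R]_(m, n)) x dx y dy :
  mderiv D M dM -> mderiv D x dx -> mderiv D y dy ->
  sderiv D (fun t => form (M t) (x t) (y t))
    (fun t => form (M t) (dx t) (y t) + form (dM t) (x t) (y t)
              + form (M t) (x t) (dy t)).
Proof.
move=> MD xD yD.
have H := mderivM (mderivM (mderivT xD) MD) yD.
apply: (sderiv_ext (H 0 0)) => t _ //.
by rewrite /form mulmxDl mxE; congr (_ + _); rewrite mxE.
Qed.

Lemma form1 (R : realType) (n : nat) (x y : 'cV[R]_n) :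
  form 1%:M x y = (x^T *m y) 0 0.
Proof. by rewrite /form mulmx1. Qed.

Lemma mderiv_sqn (R : realType) (n : nat) (D : set R) (x dx : R -> 'cV[R]_n) :
  mderiv D x dx ->
  sderiv D (fun t => sqn (x t)) (fun t => 2 * ((x t)^T *m dx t) 0 0).
Proof.
move=> xD; apply: (sderiv_ext (mderiv_form (@mderiv_cst _ _ _ D 1%:M) xD xD)) => t _.
  by rewrite form1.
have -> : @form R n n 0 (x t) (x t) = 0 by rewrite /form mulmx0 mul0mx mxE.
rewrite (form_tr _ (dx t)) trmx1 !form1 addr0.
by rewrite mulr_natl mulr2n.
Qed.

Lemma sderiv_bounded (R : realType) (f df : R -> R) (T : R) :
  sderiv `[0, +oo[ f df -> exists b, forall t, 0 <= t <= T -> `|f t| <= b.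
Proof.
move=> fD; have [T0|T0] := leP 0 T; last first.
  by exists 0 => t /andP[t0 tT]; move: (le_trans t0 tT); rewrite leNgt T0.
have fc := @sderiv_within_continuous _ f df 0 0 T fD (lexx _).
have [c1 _ c1P] := EVT_max T0 fc.
have [c2 _ c2P] := EVT_min T0 fc.
exists (`|f c1| + `|f c2|) => t t0T.
have tI : t \in `[0, T] by rewrite in_itv.
rewrite ler_norml; apply/andP; split.
  rewrite lerNl; apply: (@le_trans _ _ `|f c2|); last by rewrite lerDr.
  by rewrite -normrN; apply: le_trans (ler_norm _); rewrite lerN2 c2P.
apply: (@le_trans _ _ `|f c1|); last by rewrite lerDl.
by rewrite (le_trans _ (ler_norm _))// c1P.
Qed.

Lemma mderiv_bounded (R : realType) (m n : nat) (M dM : R -> 'M[R]_(m, n)) T :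
  mderiv `[0, +oo[ M dM ->
  exists2 b, 0 < b & forall t, 0 <= t <= T -> entry_le (M t) b.
Proof.
move=> MD; apply: (@entry_le_ex _ _ _ M (fun t => 0 <= t <= T)) => i j.
exact: sderiv_bounded (MD i j).
Qed.

(** The integrand is extended to the left of 0 by its value at 0; this makes
    it continuous on the line and the fundamental theorem of calculus then
    also gives the derivative at the end point 0. *)
Lemma sderiv_primitive (R : realType) (g dg : R -> R) :
  sderiv `[0, +oo[ g dg ->
  exists2 G, sderiv `[0, +oo[ G g & forall s t, 0 <= s -> s <= t ->
    \int[@lebesgue_measure R]_(r in `[s, t]) g r = G t - G s.
Proof.
move=> gD; pose h r := g (Num.max 0 r).
have hc : continuous h.
  move=> x; apply: cvg_trans (sderiv_cont (t := Num.max 0 x) gD _); last first.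
    by rewrite /= in_itv/= andbT le_max lexx.
  move=> P; rewrite /within/= !nbhs_filterE/= => /nbhs_ballP[e /= e0 eP].
  apply/nbhs_ballP; exists e => //= u ue; apply: eP.
    apply: le_lt_trans ue.
    have [x0|x0] := leP 0 x; have [u0|u0] := leP 0 u => //.
    - rewrite subr0 (ger0_norm x0); apply: le_trans (ler_norm _); lra.
    - rewrite sub0r normrN (ger0_norm u0) distrC.
      apply: le_trans (ler_norm _); lra.
    - by rewrite subr0 normr0.
  by rewrite /= in_itv/= andbT le_max lexx.
have hi (s t : R) : (@lebesgue_measure R).-integrable `[s, t] (EFin \o h).
  apply: continuous_compact_integrable; first exact: segment_compact.
  by apply: continuous_subspaceT.
exists (fun x => \int[@lebesgue_measure R]_(r in `[-1, x]) h r).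
  apply: is_derive_sderiv => t; rewrite /= in_itv/= andbT => t0.
  have [||||d1 d2] := @continuous_FTC1_closed R h (-1) t (t + 1).
  - by rewrite ltrDl.
  - exact: hi.
  - lra.
  - exact: hc.
  apply: DeriveDef => //; rewrite -derive1E d2 /h; congr g.
  by apply/max_idPr.
move=> s t s0 st; rewrite (@Rintegral_itvB _ h (BLeft (-1)) (BRight t) s).
- rewrite Rintegral_itv_obnd_cbnd; last first.
    apply: integrableS (hi s t) => //.
    by apply: subset_itvr; rewrite bnd_simp.
  apply: eq_Rintegral => x; rewrite inE/= in_itv/= => /andP[sx _].
  rewrite /h; congr g; apply/esym/max_idPr; exact: le_trans sx.
- exact: hi.
- rewrite bnd_simp; lra.
- by rewrite bnd_simp.
Qed.

(** * Inverses and transition matrices *)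

Lemma cvg_sum_real (R : realType) (T I : Type) (G : set_system T) (r : seq I)
    (P : pred I) (f : I -> T -> R) (a : I -> R) : Filter G ->
  (forall i, P i -> f i x @[x --> G] --> a i) ->
  \sum_(i <- r | P i) f i x @[x --> G] --> \sum_(i <- r | P i) a i.
Proof.
move=> FG fa; apply: cvg_big => //; exact: (@add_continuous R^o).
Qed.

Lemma cvg_prod_real (R : realType) (T I : Type) (G : set_system T) (r : seq I)
    (P : pred I) (f : I -> T -> R) (a : I -> R) : Filter G ->
  (forall i, P i -> f i x @[x --> G] --> a i) ->
  \prod_(i <- r | P i) f i x @[x --> G] --> \prod_(i <- r | P i) a i.
Proof.
move=> FG fa; apply: cvg_big => //; exact: (@mul_continuous R).
Qed.

(** By Cramer's rule an entry of the inverse is a rational function of the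
    entries of the matrix. *)
Lemma cvg_invmx (R : realType) (n : nat) (T : Type) (G : set_system T)
    {FG : Filter G} (M : T -> 'M[R]_n) (N : 'M[R]_n) :
  (forall i j, M u i j @[u --> G] --> N i j) ->
  N \in unitmx -> (\forall u \near G, M u \in unitmx) ->
  forall i j, invmx (M u) i j @[u --> G] --> invmx N i j.
Proof.
move=> MN Nu Mu i j.
have detMN : \det (M u) @[u --> G] --> \det N.
  apply: cvg_sum_real => s _; apply: cvgM; first exact: cvg_cst.
  by apply: cvg_prod_real => k _; exact: MN.
have cofMN : cofactor (M u) j i @[u --> G] --> cofactor N j i.
  rewrite expand_cofactor; under eq_fun do rewrite expand_cofactor.
  apply: cvg_sum_real => s _; apply: cvgM; first exact: cvg_cst.
  by apply: cvg_prod_real => k _; exact: MN.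
have -> : invmx N i j = (\det N)^-1 * cofactor N j i.
  by rewrite /invmx Nu !mxE.
have : (\det (M u))^-1 * cofactor (M u) j i @[u --> G] -->
    (\det N)^-1 * cofactor N j i.
  apply: cvgM => //; apply: cvgV => //.
  by move: Nu; rewrite unitmxE unitfE.
apply: cvg_trans; apply: near_eq_cvg; apply: filterS Mu => u Muu.
by rewrite /invmx Muu !mxE.
Qed.

(** The difference quotient is read off from N^-1 - M^-1 = - N^-1 (N - M) M^-1
    and continuity of the inverse. *)
Lemma mderiv_invmx (R : realType) (n : nat) (D : set R)
    (F dF : R -> 'M[R]_n) :
  mderiv D F dF -> (forall t, D t -> F t \in unitmx) ->
  mderiv D (fun t => invmx (F t))
    (fun t => - (invmx (F t) *m dF t *m invmx (F t))).
Proof.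
move=> FD Fu i j; apply/sderivP => t Dt.
have cF k l : F u k l @[u --> within D t^'] --> F t k l.
  apply: cvg_trans (sderiv_cont (FD k l) Dt).
  apply: cvg_app => P; rewrite /within/= !nbhs_filterE/=.
  by apply: filterS => u + _.
have uF : \forall u \near within D t^', F u \in unitmx.
  by rewrite near_withinE; apply: nearW => u; exact: Fu.
have cH := cvg_invmx cF (Fu _ Dt) uF.
have key : - \sum_l \sum_k invmx (F u) i k * ((u - t)^-1 * (F u k l - F t k l))
      * invmx (F t) l j @[u --> within D t^'] -->
    - \sum_l \sum_k invmx (F t) i k * dF t k l * invmx (F t) l j.
  apply: cvgN; apply: cvg_sum_real => l _; apply: cvg_sum_real => k _.
  apply: cvgM; last exact: cvg_cst.
  apply: cvgM; first exact: cH.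
  by have /sderivP/(_ _ Dt) := FD k l.
have -> : (- (invmx (F t) *m dF t *m invmx (F t))) i j =
    - \sum_l \sum_k invmx (F t) i k * dF t k l * invmx (F t) l j.
  by rewrite !mxE; congr (- _); apply: eq_bigr => l _; rewrite mxE mulr_suml.
apply: cvg_trans key; apply: near_eq_cvg; rewrite near_withinE.
apply: nearW => u Du.
have HH : invmx (F u) - invmx (F t) =
    - (invmx (F u) *m (F u - F t) *m invmx (F t)).
  rewrite mulmxBr mulmxBl mulVmx ?Fu// mul1mx -mulmxA mulmxV ?Fu// mulmx1.
  by rewrite opprB.
have -> : invmx (F u) i j - invmx (F t) i j =
   (- (invmx (F u) *m (F u - F t) *m invmx (F t))) i j by rewrite -HH !mxE.
rewrite !mxE mulrN; congr (- _); rewrite mulr_sumr; apply: eq_bigr => l _.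
rewrite mxE mulr_suml mulr_sumr; apply: eq_bigr => k _; rewrite !mxE; ring.
Qed.

(** Backward estimate for dx/dt = M x: the derivative 2 x^T M x of |x|^2 is at
    least - 2 c |x|^2. *)
Lemma linear_sqn_ge (R : realType) (n : nat) (M : R -> 'M[R]_n)
    (x : R -> 'cV[R]_n) (a s t c : R) : 0 < c -> a <= s -> s <= t ->
  mderiv `[a, +oo[ x (fun r => M r *m x r) ->
  (forall r z, a <= r -> `|form (M r) z z| <= c * sqn z) ->
  sqn (x s) <= expR (2 * c * (t - s)) * sqn (x t).
Proof.
move=> c0 as_ st xD Mc.
have := @sderiv_gronwall _ _ _ a s t (- (2 * c)) 0 (mderiv_sqn xD) as_ st.
rewrite !mul0r !addr0 mulNr expRN => H.
rewrite -ler_pdivrMl ?expR_gt0//; apply: H; first by rewrite oppr_eq0 mulf_neq0 ?gt_eqF.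
move=> r /andP[sr _]; rewrite addr0 mulmxA -/(form _ _ _) mulNr -mulrA -mulrN.
rewrite ler_pM2l// lerNl.
have := Mc r (x r) (le_trans as_ (ltW sr)); rewrite ler_norml => /andP[+ _].
by rewrite lerNl.
Qed.

(** Forward estimate for dx/dt = M x, from 2 x^T M x <= 2 c |x|^2. *)
Lemma linear_sqn_le (R : realType) (n : nat) (M : R -> 'M[R]_n)
    (x : R -> 'cV[R]_n) (a s t c : R) : 0 < c -> a <= s -> s <= t ->
  mderiv `[a, +oo[ x (fun r => M r *m x r) ->
  (forall r z, a <= r -> `|form (M r) z z| <= c * sqn z) ->
  sqn (x t) <= expR (2 * c * (t - s)) * sqn (x s).
Proof.
move=> c0 as_ st xD Mc.
have := @sderiv_gronwall _ _ _ a s t (2 * c) 0 (sderivN (mderiv_sqn xD)) as_ st.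
rewrite !mul0r !addr0 mulrN lerN2; apply; first by rewrite mulf_neq0 ?gt_eqF.
move=> r /andP[sr _]; rewrite addr0 mulmxA -/(form _ _ _) mulrN lerN2.
rewrite -mulrA ler_pM2l//; apply: le_trans (Mc r (x r) _); first exact: ler_norm.
exact: le_trans (ltW sr).
Qed.

Lemma eq_mulmx_cV (R : realType) (m n : nat) (M N : 'M[R]_(m, n)) :
  (forall v : 'cV[R]_n, M *m v = N *m v) -> M = N.
Proof.
move=> MN; apply/matrixP => i j.
have := congr1 (fun v : 'cV[R]_m => v i 0) (MN (delta_mx j 0)).
by rewrite -!colE !mxE.
Qed.

Lemma mderiv_mulmx_cst (R : realType) (m n p : nat) (D : set R)
    (M dM : R -> 'M[R]_(m, n)) (N : 'M[R]_(n, p)) :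
  mderiv D M dM -> mderiv D (fun t => M t *m N) (fun t => dM t *m N).
Proof.
move=> MD; apply: (mderiv_ext (mderivM MD (@mderiv_cst _ _ _ D N))) => t _ //.
by rewrite mulmx0 addr0.
Qed.

Arguments mderiv_mulmx_cst {R m n p D M dM} N.

(** By the backward estimate a solution of dx/dt = A x that vanishes at time
    [t] vanishes at time 0. *)
Lemma transition_unitmx (R : realType) (n : nat) (A E : R -> 'M[R]_n) c :
  0 < c -> (forall r z, 0 <= r -> `|form (A r) z z| <= c * sqn z) ->
  E 0 = 1%:M -> mderiv `[0, +oo[ E (fun t => A t *m E t) ->
  forall t, 0 <= t -> E t \in unitmx.
Proof.
move=> c0 Ac E0 ED t t0; apply: unitmx_inj => v Etv.
apply: sqn_eq0; apply/eqP; rewrite eq_le sqn_ge0 andbT.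
have vD : mderiv `[0, +oo[ (fun r => E r *m v) (fun r => A r *m (E r *m v)).
  by apply: (mderiv_ext (mderiv_mulmx_cst v ED)) => r _ //; rewrite mulmxA.
have := linear_sqn_ge c0 (lexx 0) t0 vD Ac.
by rewrite E0 mul1mx Etv sqn0 mulr0.
Qed.

(** Both sides solve dX/dt = A X on [r, +oo[ with value 1 at [r]; the forward
    estimate applied to their difference gives uniqueness. *)
Lemma transition_cocycle (R : realType) (n : nat) (A : R -> 'M[R]_n) E c :
  0 < c -> (forall r z, 0 <= r -> `|form (A r) z z| <= c * sqn z) ->
  is_transition_matrix A E ->
  forall r t, 0 <= r -> r <= t -> E r t = E 0 t *m invmx (E 0 r).
Proof.
move=> c0 Ac AE r t r0 rt; apply: eq_mulmx_cV => v.
have [E0 /has_derivative_mderiv ED] := AE 0 (lexx 0).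
have [Er /has_derivative_mderiv ErD] := AE r r0.
have uE := transition_unitmx c0 Ac E0 ED.
pose N := invmx (E 0 r) *m v.
pose z u := E r u *m v + - (E 0 u *m N).
have zD : mderiv `[r, +oo[ z (fun u => A u *m z u).
  have D1 := mderiv_mulmx_cst v ErD.
  have D2 := mderivN (mderiv_mulmx_cst N (mderiv_subset r0 ED)).
  apply: (mderiv_ext (mderivD D1 D2)) => u _ //.
  by rewrite /z mulmxDr mulmxN !mulmxA.
have Ac' u y : r <= u -> `|form (A u) y y| <= c * sqn y.
  by move=> ru; apply: Ac; exact: le_trans ru.
have := linear_sqn_le c0 (lexx r) rt zD Ac'.
have -> : z r = 0 by rewrite /z Er mul1mx /N mulKVmx ?uE// subrr.
rewrite sqn0 mulr0 => z0.
have : z t = 0 by apply: sqn_eq0; apply/eqP; rewrite eq_le z0 sqn_ge0.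
by move/eqP; rewrite subr_eq0 => /eqP ->; rewrite mulmxA.
Qed.

(** * The Riccati equation *)

Lemma form_tr_quad (R : realType) (m n : nat) (Z : 'M[R]_(m, n)) S p :
  form (Z^T *m S *m Z) p p = form S (Z *m p) (Z *m p).
Proof. by rewrite /form trmx_mul !mulmxA. Qed.

(** The completed square behind the whole proof: the left-hand side is the
    derivative of y^T P y when P solves the Riccati equation and dy/dt = - A^T
    y + S q. *)
Lemma riccati_form_identity (R : realType) (n : nat) (A S P R1 : 'M[R]_n)
    (y q dy : 'cV[R]_n) : P^T = P -> S^T = S ->
  dy = - (A^T *m y) + S *m q ->
  form P dy y + form (A *m P + P *m A^T - P *m S *m P + R1) y y + form P y dy
  = form R1 y y + form S q q - form S (P *m y - q) (P *m y - q).
Proof.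
move=> Ps Ss ->.
have e0 : form P (- (A^T *m y) + S *m q) y = form P y (- (A^T *m y) + S *m q).
  by rewrite form_tr Ps.
have e1 : form P y (- (A^T *m y) + S *m q) =
    - form (P *m A^T) y y + form S (P *m y) q.
  by rewrite formDr -scaleN1r formZr mulN1r /form trmx_mul Ps !mulmxA.
have e2 : form (A *m P) y y = form (P *m A^T) y y.
  by rewrite form_tr trmx_mul Ps.
have e3 : form (P *m S *m P) y y = form S (P *m y) (P *m y).
  by rewrite /form trmx_mul Ps !mulmxA.
have e4 : form (A *m P + P *m A^T - P *m S *m P + R1) y y =
  form (A *m P) y y + form (P *m A^T) y y - form (P *m S *m P) y y + form R1 y y.
  by rewrite !formMD formMN.
have e5 : form S (P *m y - q) (P *m y - q) =
    form S (P *m y) (P *m y) - 2 * form S (P *m y) q + form S q q.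
  rewrite -scaleN1r formDl !formDr !formZl !formZr (form_tr S q) Ss; ring.
rewrite e0 e1 e4 e2 e3 e5; ring.
Qed.

(** Estimate of the Frobenius product of [X] and [K X] by the squared
    Frobenius norm of [X], needed for Gronwall on P - P^T. *)
Lemma sum_entries_mul_le (R : realType) (n : nat) (X K : 'M[R]_n) k :
  0 <= k -> entry_le K k ->
  \sum_i \sum_j X i j * (K *m X) i j
    <= 2 * n%:R * k * \sum_i \sum_j X i j ^+ 2.
Proof.
move=> k0 Kk.
apply: (@le_trans _ _
    (\sum_i \sum_j \sum_l k * (X i j ^+ 2 + X l j ^+ 2))).
  apply: ler_sum => i _; apply: ler_sum => j _.
  rewrite mxE mulr_sumr; apply: ler_sum => l _.
  apply: le_trans (ler_norm _) _; rewrite !normrM mulrCA ler_pM ?mulr_ge0//.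
  rewrite -(real_normK (num_real (X i j))) -(real_normK (num_real (X l j))).
  have := sqr_ge0 (`|X i j| - `|X l j|).
  have := sqr_ge0 (`|X i j| + `|X l j|); nra.
under eq_bigr => i _ do under eq_bigr => j _ do
  rewrite -mulr_sumr big_split/= sumr_const card_ord.
under eq_bigr => i _ do rewrite -mulr_sumr big_split/= sumrMnl exchange_big/=.
rewrite -mulr_sumr big_split/= sumrMnl sumr_const card_ord.
rewrite -[X in k * (_ + X)]mulr_natl -[X in k * (X + _)]mulr_natl.
by rewrite le_eqVlt; apply/orP; left; apply/eqP; ring.
Qed.

(** The solution of dy/dt = - A^T y with value [v] at time [T], when [F] is
    the transition matrix from time 0. *)
Definition adjoint_path (R : realType) (n : nat) (F : R -> 'M[R]_n)
    (T : R) (v : 'cV[R]_n) (u : R) : 'cV[R]_n :=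
  (invmx (F u))^T *m ((F T)^T *m v).

(** In units of |v|^2, over a window of length [h] whose Gramian is at least
    [varpi]: [k1] bounds |q|^2, [k2] bounds |y|^2, and the energy grows at
    rate at most [rho1 * k2 + sigma * k1]. The summand 1 makes the value
    positive also when [h] is zero. *)
Definition riccati_ceiling (R : realType) (a sigma rho1 h varpi : R) : R :=
  let k1 := expR (2 * a * h) / varpi ^+ 2 in
  let c := 2 * a + sigma in
  let k2 := expR (c * h) * (1 + sigma * k1 / c) in
  (rho1 * k2 + sigma * k1) * h + 1.

Lemma riccati_ceiling_gt0 (R : realType) (a sigma rho1 h varpi : R) :
  0 < a -> 0 < sigma -> 0 < rho1 -> 0 <= h -> 0 < varpi ->
  0 < riccati_ceiling a sigma rho1 h varpi.
Proof.
move=> a0 sigma0 rho1_gt0 h0 varpi0; rewrite /riccati_ceiling.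
have c0 : 0 < 2 * a + sigma by rewrite addr_gt0// mulr_gt0.
have k1p : 0 < expR (2 * a * h) / varpi ^+ 2.
  by rewrite divr_gt0 ?expR_gt0 ?exprn_gt0.
rewrite ltr_wpDl// mulr_ge0// addr_ge0// mulr_ge0 ?(ltW k1p) ?ltW//.
by rewrite mulr_gt0 ?expR_gt0// addr_gt0// divr_gt0// mulr_gt0.
Qed.

Section riccati.
Variables (R : realType) (n : nat) (A S dA dS P F : R -> 'M[R]_n).
Variables (R1 : 'M[R]_n) (a sigma rho0 rho1 : R).
Local Notation D := (`[0, +oo[%classic : set R).
Hypothesis FD : mderiv D F (fun t => A t *m F t).
Hypothesis F0 : F 0 = 1%:M.
Hypothesis AD : mderiv D A dA.
Hypothesis SD : mderiv D S dS.
Hypothesis PD : mderiv D P (fun t => A t *m P t + P t *m (A t)^T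
                - P t *m S t *m P t + R1).
Hypothesis P0 : spd (P 0).
Hypothesis a0 : 0 < a.
Hypothesis Aa : forall r z, 0 <= r -> `|form (A r) z z| <= a * sqn z.
Hypothesis sigma0 : 0 < sigma.
Hypothesis Ss : forall r, (S r)^T = S r.
Hypothesis Sp : forall r z, 0 <= form (S r) z z.
Hypothesis Ssigma : forall r z, 0 <= r -> form (S r) z z <= sigma * sqn z.
Hypothesis R1s : R1^T = R1.
Hypothesis rho0_gt0 : 0 < rho0.
Hypothesis R1ge : forall z, rho0 * sqn z <= form R1 z z.
Hypothesis rho1_gt0 : 0 < rho1.
Hypothesis R1le : forall z, form R1 z z <= rho1 * sqn z.

(** The difference X = P - P^T satisfies dX/dt = K X + X K^T with K = A - P^T
    S, which is bounded on [0, t]; so the squared Frobenius norm of X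
    satisfies a linear differential inequality with zero initial value. *)
Lemma riccati_sym t : 0 <= t -> (P t)^T = P t.
Proof.
move=> t0.
pose X u := P u + - (P u)^T.
pose K u := A u + - ((P u)^T *m S u).
have XD : mderiv D X (fun u => K u *m X u + X u *m (K u)^T).
  apply: (mderiv_ext (mderivD PD (mderivN (mderivT PD)))) => u _ //.
  rewrite /X /K !linearD/= !linearN/= !trmx_mul !trmxK Ss R1s.
  rewrite !mulmxBl !mulmxA.
  move: (A u *m P u) (P u *m (A u)^T) (P u *m S u *m P u) ((P u)^T *m (A u)^T)
    (A u *m (P u)^T) ((P u)^T *m S u *m P u) ((P u)^T *m S u *m (P u)^T).
  move=> M1 M2 M3 M4 M5 M6 M7; apply/matrixP => i j; rewrite !mxE; ring.
have KD : mderiv D K (fun u => dA u + - ((A u *m P u + P u *m (A u)^T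
    - P u *m S u *m P u + R1)^T *m S u + (P u)^T *m dS u)).
  exact: mderivD AD (mderivN (mderivM (mderivT PD) SD)).
have [k k0 Kk] := mderiv_bounded t KD.
pose f u := \sum_i \sum_j X u i j ^+ 2.
have fD : sderiv D f (fun u => \sum_i \sum_j
    2 * (X u i j * (K u *m X u + X u *m (K u)^T) i j)).
  apply: sderiv_sum => i; apply: sderiv_sum => j.
  by apply: (sderiv_ext (sderivM (XD i j) (XD i j))) => u _; ring.
have f0 u : 0 <= f u.
  by apply: sumr_ge0 => i _; apply: sumr_ge0 => j _; exact: sqr_ge0.
pose c := 8 * n%:R * k + 1.
have c0 : 0 < c.
  by rewrite ltr_wpDl// mulr_ge0 ?mulr_ge0 ?(ltW k0).
have := @sderiv_gronwall _ _ _ 0 0 t c 0 (sderivN fD) (lexx 0) t0.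
rewrite gt_eqF// mul0r !addr0 subr0 => /(_ isT) H.
have {H} : expR (c * t) * - f 0 <= - f t.
  apply: H => u /andP[u0 ut]; rewrite addr0 mulrN lerN2.
  have Kuk : entry_le (K u) k by apply: Kk; rewrite !ltW.
  have H1 := sum_entries_mul_le (X u) (ltW k0) Kuk.
  (* the term X K^T is the transpose of K X^T *)
  have H2 := sum_entries_mul_le (X u)^T (ltW k0) Kuk.
  have E2 : \sum_i \sum_j (X u)^T i j * (K u *m (X u)^T) i j =
      \sum_i \sum_j X u i j * (X u *m (K u)^T) i j.
    rewrite exchange_big; apply: eq_bigr => i _; apply: eq_bigr => j _.
    have -> : K u *m (X u)^T = (X u *m (K u)^T)^T by rewrite trmx_mul trmxK.
    by rewrite !mxE.
  have E3 : \sum_i \sum_j (X u)^T i j ^+ 2 = f u.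
    rewrite exchange_big; apply: eq_bigr => i _; apply: eq_bigr => j _.
    by rewrite mxE.
  rewrite E2 E3 in H2.
  have -> : \sum_i \sum_j 2 * (X u i j * (K u *m X u + X u *m (K u)^T) i j) =
      2 * (\sum_i \sum_j X u i j * (K u *m X u) i j
           + \sum_i \sum_j X u i j * (X u *m (K u)^T) i j).
    rewrite -big_split/= mulr_sumr; apply: eq_bigr => i _.
    rewrite -big_split/= mulr_sumr; apply: eq_bigr => j _.
    by rewrite -mulrDr; congr (_ * (_ * _)); rewrite mxE.
  rewrite -/(f u) in H1; have := f0 u; rewrite /c; nra.
have -> : f 0 = 0.
  rewrite /f /X P0.1 subrr; apply: big1 => i _; apply: big1 => j _.
  by rewrite mxE expr0n.
rewrite oppr0 mulr0 oppr_ge0 => ft.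
have /eqP : f t = 0 by apply/eqP; rewrite eq_le ft f0.
rewrite psumr_eq0; last by move=> i _; apply: sumr_ge0 => j _; exact: sqr_ge0.
move=> /allP X0; apply/esym/matrixP => i j; apply/eqP.
have /= := X0 i (mem_index_enum _).
rewrite psumr_eq0; last by move=> k' _; exact: sqr_ge0.
move=> /allP/(_ j (mem_index_enum _))/=.
by rewrite sqrf_eq0 /X !mxE subr_eq0.
Qed.

Local Notation H u := (invmx (F u)).

Lemma transition_unit t : 0 <= t -> F t \in unitmx.
Proof. exact: (transition_unitmx a0 Aa F0 FD). Qed.

Lemma adjoint_mderiv :
  mderiv D (fun u => (H u)^T) (fun u => - ((A u)^T *m (H u)^T)).
Proof.
have uF u : D u -> F u \in unitmx.
  by rewrite /= in_itv/= andbT; exact: transition_unit.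
apply: (mderiv_ext (mderivT (mderiv_invmx FD uF))) => u Du //.
by rewrite -mulmxA linearN/= !mulmxA mulmxK ?uF// trmx_mul.
Qed.

Lemma adjoint_form_le r z : 0 <= r -> `|form (- (A r)^T) z z| <= a * sqn z.
Proof. by move=> r0; rewrite formMN normrN -form_tr; exact: Aa. Qed.

Lemma riccati_form_sderiv (y q : R -> 'cV[R]_n) :
  mderiv D y (fun u => - ((A u)^T *m y u) + S u *m q u) ->
  sderiv D (fun u => form (P u) (y u) (y u))
    (fun u => form R1 (y u) (y u) + form (S u) (q u) (q u)
              - form (S u) (P u *m y u - q u) (P u *m y u - q u)).
Proof.
move=> yD; apply: (sderiv_ext (mderiv_form PD yD yD)) => u Du //.
apply: riccati_form_identity => //; apply: riccati_sym.
by move: Du; rewrite /= in_itv/= andbT.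
Qed.
Local Notation adj := (adjoint_path F).

Lemma adj_mderiv T v : mderiv D (adj T v) (fun u => - (A u)^T *m adj T v u).
Proof.
apply: (mderiv_ext (mderiv_mulmx_cst _ adjoint_mderiv)) => u _ //.
by rewrite !mulNmx /adjoint_path !mulmxA.
Qed.

Arguments adj_mderiv : clear implicits.

Lemma adj_end T v : 0 <= T -> adj T v T = v.
Proof.
move=> T0; rewrite /adjoint_path mulmxA -trmx_mul mulmxV ?transition_unit//.
by rewrite trmx1 mul1mx.
Qed.

(** The energy identity for the signal q = 0. *)
Lemma adj_energy_mderiv T v : sderiv D (fun u => form (P u) (adj T v u) (adj T v u))
  (fun u => form R1 (adj T v u) (adj T v u)
            - form (S u) (P u *m adj T v u) (P u *m adj T v u)).
Proof.
have yD : mderiv D (adj T v)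
    (fun u => - ((A u)^T *m adj T v u) + S u *m (fun=> 0) u).
  apply: (mderiv_ext (adj_mderiv T v)) => u _ //.
  by rewrite mulmx0 addr0 mulNmx.
apply: (sderiv_ext (riccati_form_sderiv yD)) => u _ //.
by rewrite subr0 [form (S u) 0 0]/form mulmx0 mxE addr0.
Qed.

Arguments adj_energy_mderiv : clear implicits.

Lemma adj_sqn_ge T v s : 0 <= s -> s <= T ->
  sqn v <= expR (2 * a * (T - s)) * sqn (adj T v s).
Proof.
move=> s0 sT.
have := linear_sqn_le a0 s0 sT (adj_mderiv T v) adjoint_form_le.
by rewrite adj_end// (le_trans s0).
Qed.

(** The quadratic loss (P y)^T S (P y) is at most sigma lam times the energy,
    which turns the energy identity into a linear inequality. The extra 1 in
    the rate keeps it nonzero, as the Gronwall estimate requires. *)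
Lemma riccati_energy_ge T v u lam : 0 <= lam -> 0 <= u ->
  psd (P u) -> (forall z, form (P u) z z <= lam * sqn z) ->
  - (sigma * lam + 1) * form (P u) (adj T v u) (adj T v u)
    + form R1 (adj T v u) (adj T v u)
  <= form R1 (adj T v u) (adj T v u)
            - form (S u) (P u *m adj T v u) (P u *m adj T v u).
Proof.
move=> lam0 u0 Pp Plam; set y := adj T v u.
rewrite addrC lerD2l mulNr lerN2 mulrDl mul1r.
have h1 := psd_sqr_le lam0 Pp Plam y.
have h2 := Ssigma (P u *m y) u0.
have h3 : 0 <= form (P u) y y := Pp.2 y.
apply: le_trans h2 _; rewrite -mulrA -[leLHS]addr0 lerD// ler_pM2l//.
Qed.

(** Positivity is required on the open interval only: the conclusion is a
    strict bound at the end point, which is what lets positivity be continued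
    past it. *)
Lemma riccati_pos_lower T lam : 0 <= T -> 0 <= lam ->
  (forall u z, 0 <= u <= T -> form (P u) z z <= lam * sqn z) ->
  (forall u, 0 < u < T -> psd (P u)) ->
  exists2 k, 0 < k & forall v, k * sqn v <= form (P T) v v.
Proof.
move=> T0 lam0 Plam Pp; have [q q0 qP] := spd_lower P0.
exists (expR (- (sigma * lam + 1) * T) * (q * (expR (2 * a * T))^-1)).
  by rewrite !mulr_gt0 ?invr_gt0 ?expR_gt0.
move=> v.
have c0 : - (sigma * lam + 1) != 0.
  by rewrite oppr_eq0 gt_eqF// ltr_wpDl// mulr_ge0// ltW.
have := @sderiv_gronwall _ _ _ 0 0 T _ 0 (adj_energy_mderiv T v) (lexx _) T0 c0.
rewrite mul0r !addr0 subr0 adj_end// => H1; apply: le_trans (H1 _).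
  rewrite -[leLHS]mulrA ler_pM2l ?expR_gt0//; apply: le_trans (qP _).
  rewrite -[leLHS]mulrA ler_pM2l// ler_pdivrMl ?expR_gt0//.
  by have := adj_sqn_ge v (lexx 0) T0; rewrite subr0.
move=> u /andP[u0 uT]; apply: le_trans (riccati_energy_ge _ _ lam0 (ltW u0) _ _) => //.
- rewrite lerD2l; apply: le_trans (R1ge _); rewrite mulr_ge0 ?sqn_ge0//; exact: ltW.
- by apply: Pp; rewrite u0.
- by move=> z; apply: Plam; rewrite !ltW.
Qed.

(** Let T be the infimum of the times where the claim fails. Up to T the form
    is nonnegative, so at T it is at least k |z|^2 with k > 0; by continuity
    it stays nonnegative on a right neighbourhood of T, which contradicts the
    choice of T. *)
Lemma riccati_psd t : 0 <= t -> psd (P t).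
Proof.
move=> t0; apply: contrapT => Pt.
pose B := [set u | 0 <= u /\ ~ psd (P u)].
have Bt : B t by [].
have Binf : has_inf B by split; [exists t|exists 0 => u []].
pose T := inf B.
have T0 : 0 <= T by apply: lb_le_inf => [|u []//]; exists t.
have Pp u : 0 <= u < T -> psd (P u).
  move=> /andP[u0 uT]; apply: contrapT => Pu.
  by have := ge_inf Binf.2 (conj u0 Pu : B u); rewrite leNgt uT.
have [b b0 bP] := mderiv_bounded T PD.
have [k k0 kP] : exists2 k, 0 < k & forall v, k * sqn v <= form (P T) v v.
  apply: (@riccati_pos_lower T (b * (2 * n%:R + 1))) => //.
  - by rewrite mulr_ge0 ?addr_ge0 ?mulr_ge0 // ltW.
  - move=> u z uT; apply: le_trans (ler_norm _) _.
    by apply: form_sqn_le; [exact: ltW|exact: bP].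
  - by move=> u /andP[u0 uT]; apply: Pp; rewrite ltW.
pose e := k / (2 * n%:R + 1).
have n0 : 0 < 2 * n%:R + 1 :> R by rewrite ltr_wpDl// mulr_ge0.
have e0 : 0 < e by rewrite divr_gt0.
have DT : D T by rewrite /= in_itv/= T0.
have : \forall u \near within D (nbhs T), forall i, forall j, `|P T i j - P u i j| < e.
  apply: filter_forall => i; apply: filter_forall => j.
  by have /cvgrPdist_lt/(_ _ e0) := sderiv_cont (@PD i j) DT.
rewrite near_withinE => /nbhs_ballP[d /= d0 dP].
have [u [u0 Pu] uTd] := inf_adherent d0 Binf.
have uT : T <= u := ge_inf Binf.2 (conj u0 Pu : B u).
apply: Pu; split; first exact: riccati_sym.
move=> z; rewrite -/(form _ _ _).
(* e is tuned so that an entrywise perturbation of size e moves the form by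
   at most k |z|^2 *)
have le_e : entry_le (P u - P T) e.
  move=> i j; rewrite !mxE distrC ltW//; apply: dP.
    rewrite /ball/= distrC ger0_norm ?subr_ge0// ltrBlDl//.
  by rewrite /= in_itv/= u0.
have := form_sqn_le z (ltW e0) le_e.
rewrite /e divfK ?gt_eqF// formMD formMN ler_norml => /andP[+ _].
have := kP z; lra.
Qed.

(** Gronwall for the energy of an adjoint path on [s, t], with source rho0
    |y|^2 >= rho0 exp (- 2 a (t - s)) |v|^2; what happened before [s] only
    enters through the sign of the energy at [s]. *)
Lemma riccati_lower t s lam : 0 <= s -> s < t -> 0 < lam ->
  (forall u z, s <= u <= t -> form (P u) z z <= lam * sqn z) ->
  forall v, rho0 * expR (- (2 * a * (t - s))) / (sigma * lam + 1)
    * (1 - expR (- (sigma * lam + 1) * (t - s))) * sqn v <= form (P t) v v.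
Proof.
move=> s0 st lam0 Plam v.
have t0 : 0 <= t by exact: le_trans (ltW st).
set c := sigma * lam + 1.
have c0 : 0 < c by rewrite ltr_wpDl// mulr_ge0// ltW.
have c0' : - c != 0 by rewrite oppr_eq0 gt_eqF.
pose k := rho0 * expR (- (2 * a * (t - s))) * sqn v.
have := @sderiv_gronwall _ _ _ 0 s t _ k (adj_energy_mderiv t v) s0 (ltW st) c0'.
rewrite adj_end// => H1.
have {}H1 : expR (- c * (t - s)) *
    (form (P s) (adj t v s) (adj t v s) + k / - c) <= form (P t) v v + k / - c.
  apply: H1 => u /andP[su ut].
  have u0 : 0 <= u by exact: le_trans (ltW su).
  apply: le_trans (riccati_energy_ge _ _ (ltW lam0) u0 _ _) => //.
  - rewrite lerD2l; apply: le_trans (R1ge _); rewrite /k -mulrA ler_pM2l//.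
    rewrite expRN ler_pdivrMl ?expR_gt0//; apply: le_trans (adj_sqn_ge v u0 (ltW ut)) _.
    rewrite ler_wpM2r ?sqn_ge0// ler_expR ler_pM2l ?mulr_gt0// lerD2l lerN2; exact: ltW.
  - exact: riccati_psd.
  - by move=> z; apply: Plam; rewrite !ltW.
have Y0 : 0 <= form (P s) (adj t v s) (adj t v s) := (riccati_psd s0).2 _.
have X0 := expR_gt0 (- c * (t - s)).
have -> : rho0 * expR (- (2 * a * (t - s))) / c * (1 - expR (- c * (t - s))) * sqn v
   = k / c - expR (- c * (t - s)) * (k / c) by rewrite /k; ring.
rewrite invrN mulrN in H1; nra.
Qed.

(** The matrix [G] is a primitive of the integrand of the observability
    Gramian of the window [s, s + h], where Z u is the inverse of the
    transition matrix from u to s + h. The path y u = (Z u)^-T (G u - G s) p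
    leads from 0 to v when p = (G (s + h) - G s)^-1 v, and is driven by q u =
    Z u p. *)
Lemma riccati_upper h varpi (s : R) (G : R -> 'M[R]_n) :
  0 <= h -> 0 < varpi -> 0 <= s ->
  let Z u := F u *m H (s + h) in
  mderiv D G (fun u => (Z u)^T *m S u *m Z u) ->
  (forall z, varpi * sqn z <= form (G (s + h) - G s) z z) ->
  forall v,
    form (P (s + h)) v v <= riccati_ceiling a sigma rho1 h varpi * sqn v.
Proof.
move=> h0 varpi0 s0 Z GD Oge v; rewrite /riccati_ceiling.
set k1 := expR (2 * a * h) / varpi ^+ 2; set c := 2 * a + sigma.
have c0 : 0 < c by rewrite addr_gt0// mulr_gt0.
have k1p : 0 < k1 by rewrite divr_gt0 ?expR_gt0 ?exprn_gt0.
set k2 := expR (c * h) * (1 + sigma * k1 / c).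
set k3 := rho1 * k2 + sigma * k1.
have sh : s <= s + h by rewrite lerDl.
have T0 : 0 <= s + h := le_trans s0 sh.
have uT : F (s + h) \in unitmx by exact: transition_unit.
pose O := G (s + h) - G s.
have Ou : O \in unitmx.
  apply: unitmx_inj => z Oz; apply: sqn_eq0; apply/eqP.
  rewrite eq_le sqn_ge0 andbT -(ler_pM2l varpi0) mulr0.
  by apply: le_trans (Oge z) _; rewrite /form -mulmxA -/O Oz mulmx0 mxE.
pose p := invmx O *m v.
have Op : O *m p = v by rewrite /p mulKVmx.
have p_le : sqn p <= sqn v / varpi ^+ 2.
  rewrite ler_pdivlMr ?exprn_gt0//.
  have h1 : varpi * sqn p <= form 1%:M p v.
    by apply: le_trans (Oge p) _; rewrite /form mulmx1 -mulmxA -/O Op.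
  (* expanding |v - varpi p|^2 >= 0 bounds the cross term of h1 *)
  have h2 := sqn_ge0 (v + (- varpi) *: p).
  have h3 : sqn (v + (- varpi) *: p) =
      sqn v - 2 * varpi * form 1%:M p v + varpi ^+ 2 * sqn p.
    have sq1 (z : 'cV[R]_n) : sqn z = form 1%:M z z by rewrite form1.
    rewrite !sq1 formDl !formDr !formZl !formZr (form_tr _ v p) trmx1; ring.
  rewrite h3 in h2; nra.
pose q u := Z u *m p.
have qD : mderiv D q (fun u => A u *m q u).
  apply: (mderiv_ext (mderiv_mulmx_cst (H (s + h) *m p) FD)) => u _.
    by rewrite /q /Z mulmxA.
  by rewrite /q /Z !mulmxA.
have q_le u : s <= u -> u <= s + h -> sqn (q u) <= k1 * sqn v.
  move=> su ut; have u0 := le_trans s0 su.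
  apply: le_trans (linear_sqn_ge a0 u0 ut qD Aa) _.
  have -> : q (s + h) = p by rewrite /q /Z mulmxV// mul1mx.
  have -> : k1 * sqn v = expR (2 * a * h) * (sqn v / varpi ^+ 2).
    by rewrite /k1; ring.
  apply: ler_pM p_le; [exact: expR_ge0|exact: sqn_ge0|].
  rewrite ler_expR ler_pM2l ?mulr_gt0//; lra.
pose y u := (H u)^T *m ((F (s + h))^T *m ((G u - G s) *m p)).
(* variation of constants: the factor in front of G u - G s solves the
   homogeneous equation, and it is the inverse of (Z u)^T *)
have yD : mderiv D y (fun u => - ((A u)^T *m y u) + S u *m q u).
  have GsD := mderiv_mulmx_cst p (mderivD GD (@mderiv_cst _ _ _ D (- G s))).
  have D1 := mderivM (@mderiv_cst _ _ _ D (F (s + h))^T) GsD.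
  apply: (mderiv_ext (mderivM adjoint_mderiv D1)) => u Du //.
  have u0 : 0 <= u by move: Du; rewrite /= in_itv/= andbT.
  have uu : F u \in unitmx by exact: transition_unit.
  congr (_ + _); first by rewrite /y !mulNmx !mulmxA.
  rewrite mul0mx add0r addr0 /q.
  have -> : (H u)^T *m ((F (s + h))^T *m ((Z u)^T *m S u *m Z u *m p)) =
     ((Z u *m F (s + h)) *m H u)^T *m S u *m (Z u *m p).
    by rewrite !trmx_mul !mulmxA.
  by rewrite /Z mulmxKV// mulmxV// trmx1 mul1mx.
have ys : y s = 0 by rewrite /y subrr mul0mx !mulmx0.
have yt : y (s + h) = v.
  by rewrite /y -/O Op mulmxA -trmx_mul mulmxV// trmx1 mul1mx.
have y_le u : s < u -> u < s + h -> sqn (y u) <= k2 * sqn v.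
  move=> su ut; have u0 : 0 <= u := le_trans s0 (ltW su).
  have cN : - c != 0 by rewrite oppr_eq0 gt_eqF.
  have := @sderiv_gronwall _ _ _ 0 u (s + h) _ (- (sigma * (k1 * sqn v)))
    (mderiv_sqn yD) u0 (ltW ut) cN.
  rewrite yt => H1.
  have {}H1 : expR (- c * (s + h - u)) * (sqn (y u) + sigma * (k1 * sqn v) / c)
      <= sqn v + sigma * (k1 * sqn v) / c.
    rewrite -[_ / c]opprK -mulNr -mulrN -invrN; apply: H1 => r /andP[ur rt].
    have r0 : 0 <= r := le_trans u0 (ltW ur).
    have sr : s <= r := ltW (lt_trans su ur).
    rewrite mulmxDr mxE mulmxN mxE mulmxA -/(form _ _ _).
    rewrite [(y r)^T *m ((A r)^T *m y r)]mulmxA -/(form _ _ _) -form_tr.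
    have := Aa (y r) r0; rewrite ler_norml => /andP[_ h1].
    have := Sp r (y r + q r); rewrite formDl !formDr (form_tr _ (q r)) Ss => h2.
    have h3 := Ssigma (y r) r0; have h4 := Ssigma (q r) r0.
    have h5 := q_le r sr (ltW rt).
    have h6 : sigma * sqn (q r) <= sigma * (k1 * sqn v) by rewrite ler_pM2l.
    rewrite /c; lra.
  have := sqn_ge0 v; have := sqn_ge0 (y u) => y0 v0.
  (* the estimate on [u, s + h] is relaxed to the full length h, to get a
     constant that does not depend on u *)
  have e1 : expR (c * (s + h - u)) <= expR (c * h).
    rewrite ler_expR ler_pM2l//; lra.
  have kv0 : 0 <= sigma * (k1 * sqn v) / c.
    by rewrite divr_ge0 ?(ltW c0)// mulr_ge0 ?(ltW sigma0)// mulr_ge0// ltW.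
  rewrite mulNr expRN ler_pdivrMl ?expR_gt0// in H1.
  have -> : k2 * sqn v = expR (c * h) * (sqn v + sigma * (k1 * sqn v) / c).
    by rewrite /k2; ring.
  apply: le_trans (ler_wpM2r (addr_ge0 v0 kv0) e1).
  by apply: le_trans H1; rewrite lerDl.
have k3D : sderiv D (fun u => k3 * sqn v * u) (fun=> k3 * sqn v).
  apply: is_derive_sderiv => u _.
  have := @is_deriveZ R R^o R^o id (k3 * sqn v) u 1 1 (is_derive_id _ _).
  by rewrite /GRing.scale/= mulr1.
have := sderiv_ge0_le (sderivD k3D (sderivN (riccati_form_sderiv yD))) s0 sh.
move=> H1.
have {H1} : k3 * sqn v * s + - form (P s) (y s) (y s)
    <= k3 * sqn v * (s + h) + - form (P (s + h)) (y (s + h)) (y (s + h)).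
  apply: H1 => r /andP[sr rt]; rewrite subr_ge0.
  have r0 : 0 <= r := le_trans s0 (ltW sr).
  have h1 := R1le (y r); have h2 := Ssigma (q r) r0.
  have h3 := Sp r (P r *m y r - q r).
  have h4 := y_le r sr rt; have h5 := q_le r (ltW sr) (ltW rt).
  have h6 : sigma * sqn (q r) <= sigma * (k1 * sqn v) by rewrite ler_pM2l.
  have h7 : rho1 * sqn (y r) <= rho1 * (k2 * sqn v) by rewrite ler_pM2l.
  rewrite /k3; lra.
have -> : form (P s) (y s) (y s) = 0 by rewrite ys /form mulmx0 mxE.
rewrite yt; have := sqn_ge0 v; lra.
Qed.
End riccati.

(** * Uniform bounds for the flow *)

Lemma form_scalar (R : realType) (n : nat) (c : R) (z : 'cV[R]_n) :
  form c%:M z z = c * sqn z.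
Proof. by rewrite -scalemx1 /form -scalemxAr -scalemxAl mulmx1 mxE. Qed.

Lemma spd_scalar (R : realType) (n : nat) (c : R) :
  0 < c -> spd (c%:M : 'M[R]_n).
Proof.
move=> c0; split; first exact: tr_scalar_mx.
move=> x x0; rewrite -/(form _ _ _) form_scalar mulr_gt0//.
rewrite lt_neqAle sqn_ge0 andbT eq_sym; apply: contra x0 => /eqP x0.
by apply/eqP; exact: sqn_eq0.
Qed.

Lemma loewner_scalar_le (R : realType) (n : nat) (c : R) (M : 'M[R]_n) :
  M^T = M -> loewner_le c%:M M <-> forall z, c * sqn z <= form M z z.
Proof.
move=> Ms; split=> [[_ cM] z|cM].
  by have := cM z; rewrite -/(form _ _ _) formMD formMN form_scalar subr_ge0.
split; first by rewrite linearB/= tr_scalar_mx Ms.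
by move=> z; rewrite -/(form _ _ _) formMD formMN form_scalar subr_ge0.
Qed.

Lemma loewner_le_scalar (R : realType) (n : nat) (c : R) (M : 'M[R]_n) :
  M^T = M -> (forall z, form M z z <= c * sqn z) -> loewner_le M c%:M.
Proof.
move=> Ms cM; split; first by rewrite linearB/= tr_scalar_mx Ms.
by move=> z; rewrite -/(form _ _ _) formMD formMN form_scalar subr_ge0.
Qed.

Lemma mderiv_primitive (R : realType) (m n : nat) (g dg : R -> 'M[R]_(m, n)) :
  mderiv `[0, +oo[ g dg ->
  exists2 G, mderiv `[0, +oo[ G g &
    forall s t, 0 <= s -> s <= t -> integral_mx s t g = G t - G s.
Proof.
move=> gD.
have H (ij : 'I_m * 'I_n) : exists G, sderiv `[0, +oo[ G (fun t => g t ij.1 ij.2) /\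
    forall s t, 0 <= s -> s <= t ->
    \int[@lebesgue_measure R]_(r in `[s, t]) g r ij.1 ij.2 = G t - G s.
  by have [G G1 G2] := sderiv_primitive (gD ij.1 ij.2); exists G.
have [G GP] := choice H.
exists (fun t => \matrix_(i, j) G (i, j) t).
  by move=> i j; apply: (sderiv_ext (GP (i, j)).1) => t _ //; rewrite mxE.
by move=> s t s0 st; apply/matrixP => i j; rewrite !mxE (GP (i, j)).2.
Qed.

Lemma smooth_on_mderiv (R : realType) (m n : nat) (D : set R)
    (M : R -> 'M[R]_(m, n)) : smooth_on D M -> exists dM, mderiv D M dM.
Proof.
move=> [d [d0 dD]]; exists (d 1).
by apply: (mderiv_ext (has_derivative_mderiv (dD 0))) => t Dt //; exact: d0.
Qed.

Lemma info_mx_psd (R : realType) (r1 r2 : nat) (C : R -> 'M[R]_(r2, r1))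
    (R2 : 'M[R]_r2) (t : R) : spd R2 -> psd (info_mx C R2 t).
Proof.
move=> /psd_invmx[R2s R2p]; split.
  by rewrite /info_mx !trmx_mul trmxK R2s mulmxA.
by move=> z; have := R2p (C t *m z); rewrite -!/(form _ _ _) form_tr_quad.
Qed.

Lemma info_mx_bounded (R : realType) (r1 r2 : nat) (C : R -> 'M[R]_(r2, r1))
    (R2 : 'M[R]_r2) (D : set R) : [bounded C t | t in D] ->
  exists2 b, 0 < b & forall t, D t -> entry_le (info_mx C R2 t) b.
Proof.
move=> /entry_le_bounded[b b0 Cb]; have [k k0 Rk] := entry_le_ex1 (invmx R2).
exists (r2%:R * (r2%:R * (b * k) * b) + 1).
  by rewrite ltr_wpDl// !mulr_ge0// ltW.
move=> t Dt i j; apply: le_trans (_ : _ <= r2%:R * (r2%:R * (b * k) * b)) _; last first.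
  by rewrite lerDl.
apply: entry_le_mul; last exact: Cb.
by apply: entry_le_mul => //; apply: entry_le_tr; exact: Cb.
Qed.

Theorem theorem1p1 (R : realType) (r1 r2 : nat)
    (hr1 : (1 <= r1)%N) (hr2 : (1 <= r2)%N)
    (A : R -> 'M[R]_r1) (C : R -> 'M[R]_(r2, r1))
    (A_smooth : smooth_on `[0, +oo[ A) (C_smooth : smooth_on `[0, +oo[ C)
    (A_bounded : [bounded A t | t in `[0, +oo[])
    (C_bounded : [bounded C t | t in `[0, +oo[])
    (R1 : 'M[R]_r1) (R2 : 'M[R]_r2) (R1_spd : spd R1) (R2_spd : spd R2)
    (phi : R -> R -> 'M[R]_r1 -> 'M[R]_r1)
    (phi_riccati : is_riccati_flow A C R1 R2 phi)
    (E : R -> R -> 'M[R]_r1) (E_transition : is_transition_matrix A E)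
    (upsilon0 varpi_c_min varpi_c_max varpi_o_min varpi_o_max : R)
    (upsilon0_gt0 : 0 < upsilon0)
    (varpi_c_min_gt0 : 0 < varpi_c_min) (varpi_c_max_gt0 : 0 < varpi_c_max)
    (varpi_o_min_gt0 : 0 < varpi_o_min) (varpi_o_max_gt0 : 0 < varpi_o_max)
    (controllable : forall t : R, 0 <= t ->
      loewner_le varpi_c_min%:M (ctrl_gramian E R1 t (t + upsilon0)) /\
      loewner_le (ctrl_gramian E R1 t (t + upsilon0)) varpi_c_max%:M)
    (observable : forall t : R, 0 <= t ->
      loewner_le varpi_o_min%:M (obs_gramian E C R2 t (t + upsilon0)) /\
      loewner_le (obs_gramian E C R2 t (t + upsilon0)) varpi_o_max%:M) :
  exists (upsilon : R) (Lambda_min Lambda_max : 'M[R]_r1),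
    [/\ 0 < upsilon, spd Lambda_min, spd Lambda_max &
      forall (t : R) (Q : 'M[R]_r1), upsilon <= t -> spd Q ->
        loewner_le Lambda_min (phi 0 t Q) /\
        loewner_le (phi 0 t Q) Lambda_max].
Proof.
pose d1 : R := 2 * r1%:R + 1.
have d1_gt0 : 0 < d1 by rewrite ltr_wpDl// mulr_ge0.
have D0 r : 0 <= r -> `[0, +oo[%classic r by move=> r0; rewrite /= in_itv/= r0.
have [al al0 Aal] := entry_le_bounded A_bounded.
pose a := al * d1; have a0 : 0 < a by rewrite mulr_gt0.
have Aa r z : 0 <= r -> `|form (A r) z z| <= a * sqn z.
  by move=> r0; apply: form_sqn_le; [exact: ltW|exact/Aal/D0].
pose S := info_mx C R2.
have [si si0 Ssi] := info_mx_bounded R2 C_bounded.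
pose sigma := si * d1; have sigma0 : 0 < sigma by rewrite mulr_gt0.
have Ss r : (S r)^T = S r by exact: (info_mx_psd _ _ R2_spd).1.
have Sp r z : 0 <= form (S r) z z by exact: (info_mx_psd _ _ R2_spd).2.
have Ssigma r z : 0 <= r -> form (S r) z z <= sigma * sqn z.
  move=> r0; apply: le_trans (ler_norm _) _.
  by apply: form_sqn_le; [exact: ltW|exact/Ssi/D0].
have [rho0 rho0_gt0 R1ge] := spd_lower R1_spd.
have [be be0 R1be] := entry_le_ex1 R1.
pose rho1 := be * d1; have rho1_gt0 : 0 < rho1 by rewrite mulr_gt0.
have R1le z : form R1 z z <= rho1 * sqn z.
  by apply: le_trans (ler_norm _) _; apply: form_sqn_le; [exact: ltW|].
have [dA AD] := smooth_on_mderiv A_smooth.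
have [dC CD] := smooth_on_mderiv C_smooth.
have SD := mderivM (mderiv_mulmx_cst (invmx R2) (mderivT CD)) CD.
have [F0 /has_derivative_mderiv FD] := E_transition 0 (lexx 0).
have uF := transition_unitmx a0 Aa F0 FD.
pose K := riccati_ceiling a sigma rho1 upsilon0 varpi_o_min.
have K0 : 0 < K by apply: riccati_ceiling_gt0 => //; exact: ltW.
have phi_le Q t z : spd Q -> upsilon0 <= t -> form (phi 0 t Q) z z <= K * sqn z.
  move=> Qp ut; have [P0 /has_derivative_mderiv PD] := phi_riccati 0 Q (lexx 0) Qp.
  pose s := t - upsilon0; have s0 : 0 <= s by rewrite subr_ge0.
  have -> : t = s + upsilon0 by rewrite subrK.
  pose Z u := E 0 u *m invmx (E 0 (s + upsilon0)).
  have ZD := mderiv_mulmx_cst (invmx (E 0 (s + upsilon0))) FD.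
  have [G GD Gint] := mderiv_primitive (mderivM (mderivM (mderivT ZD) SD) ZD).
  (* the cocycle rule turns the inverse of E r T into F r F(T)^-1, which depends
     differentiably on r *)
  have obsE : obs_gramian E C R2 s (s + upsilon0) = G (s + upsilon0) - G s.
    rewrite -Gint ?lerDl ?(ltW upsilon0_gt0)//.
    apply/matrixP => i j; rewrite !mxE; apply: eq_Rintegral => r.
    rewrite inE/= in_itv/= => /andP[sr rt].
    have r0 := le_trans s0 sr.
    have -> : invmx (E r (s + upsilon0)) = E 0 r *m invmx (E 0 (s + upsilon0)).
      have tu := uF _ (le_trans r0 rt).
      rewrite (transition_cocycle a0 Aa E_transition r0 rt).
      set X := E 0 (s + upsilon0) *m invmx (E 0 r).
      have XY : X *m (E 0 r *m invmx (E 0 (s + upsilon0))) = 1%:M.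
        by rewrite /X mulmxA mulmxKV ?uF// mulmxV.
      have [Xu _] := mulmx1_unit XY.
      by rewrite -[RHS](mulKmx Xu) XY mulmx1.
    by [].
  have Os : (G (s + upsilon0) - G s)^T = G (s + upsilon0) - G s.
    rewrite -obsE; have [[+ _] _] := observable s s0.
    by rewrite linearB/= tr_scalar_mx => /addIr.
  have Oge z' : varpi_o_min * sqn z' <= form (G (s + upsilon0) - G s) z' z'.
    by apply/loewner_scalar_le : z' => //; rewrite -obsE; exact: (observable s s0).1.
  have P0p : spd (phi 0 0 Q) by rewrite P0.
  exact: (riccati_upper FD F0 AD SD PD P0p a0 Aa sigma0 Ss Sp Ssigma R1_spd.1
    rho1_gt0 R1le (ltW upsilon0_gt0) varpi_o_min_gt0 s0 GD Oge).
(* the window [t - upsilon0, t] starts at time upsilon0 or later, so the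
   ceiling K already holds on it *)
pose l := rho0 * expR (- (2 * a * upsilon0)) / (sigma * K + 1)
    * (1 - expR (- (sigma * K + 1) * upsilon0)).
exists (2 * upsilon0), l%:M, K%:M; split.
- by rewrite mulr_gt0.
- apply: spd_scalar; rewrite mulr_gt0 ?divr_gt0 ?mulr_gt0 ?expR_gt0//.
    by rewrite addr_gt0// mulr_gt0.
  rewrite subr_gt0 -expR0 ltr_expR mulNr oppr_lt0 mulr_gt0// addr_gt0//.
  exact: mulr_gt0.
- exact: spd_scalar.
move=> t Q ut Qp.
have t0 : 0 <= t by apply: le_trans ut; rewrite mulr_ge0// ltW.
have [P0 /has_derivative_mderiv PD] := phi_riccati 0 Q (lexx 0) Qp.
have P0p : spd (phi 0 0 Q) by rewrite P0.
split.
  apply/loewner_scalar_le; first by apply: (riccati_sym AD SD PD P0p Ss R1_spd.1).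
  move=> z; have s0 : 0 <= t - upsilon0 by lra.
  have st : t - upsilon0 < t by lra.
  have := riccati_lower FD F0 AD SD PD P0p a0 Aa sigma0 Ss Ssigma R1_spd.1
    rho0_gt0 R1ge s0 st K0.
  rewrite (_ : t - (t - upsilon0) = upsilon0); last by ring.
  apply=> u z' /andP[u0 _]; apply: phi_le => //; lra.
apply: loewner_le_scalar; first exact: (riccati_sym AD SD PD P0p Ss R1_spd.1).
by move=> z; apply: phi_le => //; lra.
Qed.
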